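(* Let $\gamma_D$ and $\gamma_E$ be independent nonnegative random variables, where for $i\in\{D,E\}$ the variable $\gamma_i$ is the instantaneous SNR of a fluctuating two-ray (FTR) fading channel with parameters $m_i>0$, $K_i\ge 0$, $\Delta_i\in[0,1]$, $\sigma_i^2>0$, i.e. $\gamma_i$ has the density $f_i$ given in the context, with coefficients $d_{j_i}$ as defined there. Let $R_s\ge 0$, $\Theta=e^{R_s}$, and $$\rho=\frac{\sigma_D^2(K_D+1)}{\sigma_E^2(K_E+1)},\qquad \eta=\frac{K_E+1}{K_D+1}.$$ Then the lower bound $SOP^L=P\{\gamma_D<\Theta\gamma_E\}$ of the secrecy outage probability $SOP=P\{\gamma_D<\Theta\gamma_E+\Theta-1\}$ equals $$ \begin{aligned} SOP^L={}&\frac{m_D^{m_D}m_E^{m_E}}{\Gamma(m_D)\Gamma(m_E)}\sum_{j_D=0}^\infty\sum_{j_E=0}^\infty\frac{K_D^{j_D}d_{j_D}K_E^{j_E}d_{j_E}}{j_D!\,j_E!}\\ &\times\frac{(\rho\eta)^{j_E}\,\Theta^{j_D+1}}{(\Theta+\rho\eta)^{j_D+j_E+1}}\sum_{k=0}^{j_E}\Big(\frac{\Theta}{\rho\eta}\Big)^k\frac{(j_D+j_E+1)!}{(j_D+1+k)!\,(j_E-k)!}. \end{aligned} $$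
   Context: For $i\in\{D,E\}$ ($D$: main channel to the legitimate receiver; $E$: eavesdropper channel), the FTR fading SNR $\gamma_i$ has probability density on $(0,\infty)$ $$f_i(\gamma)=\frac{m_i^{m_i}}{\Gamma(m_i)}\sum_{j_i=0}^\infty \frac{K_i^{j_i}d_{j_i}}{j_i!\,j_i!}\,\frac{\gamma^{j_i}}{(2\sigma_i^2)^{j_i+1}}\exp\Big(-\frac{\gamma}{2\sigma_i^2}\Big),$$ and cumulative distribution function $$F_i(\gamma)=\frac{m_i^{m_i}}{\Gamma(m_i)}\sum_{j_i=0}^\infty \frac{K_i^{j_i}d_{j_i}}{j_i!\,j_i!}\,\gamma\Big(j_i+1,\frac{\gamma}{2\sigma_i^2}\Big),$$ where $\gamma(a,x)=\int_0^x t^{a-1}e^{-t}\,dt$ is the lower incomplete gamma function. The coefficients $d_{j_i}$ depend on $(m_i,K_i,\Delta_i)$ and the index $j_i$ (so $d_{j_D}$ uses the parameters of channel $D$ and $d_{j_E}$ those of channel $E$): $$d_{j_i}=\frac{\Gamma(j_i+m_i)}{\pi}\int_0^{\pi}\frac{(1+\Delta_i\cos\theta)^{j_i}}{(m_i+K_i+K_i\Delta_i\cos\theta)^{j_i+m_i}}\,d\theta .$$ The quantity $\rho$ is the ratio $\bar\gamma_D/\bar\gamma_E$ of the average SNRs, with identical $E_b/N_0$ and unit-normalized propagation distances for both channels. The convention $0^0=1$ is used. *)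

(* Defs.v *)
From HB Require Import structures.
From mathcomp Require Export all_boot all_order all_algebra.
From mathcomp Require Export all_classical all_reals all_analysis.

Set Implicit Arguments.
Unset Strict Implicit.
Unset Printing Implicit Defensive.

Export Order.TTheory GRing.Theory Num.Theory.
Export numFieldNormedType.Exports.

Local Open Scope classical_set_scope.
Local Open Scope ring_scope.

Section ftr.
Context {R : realType}.
Notation mu := (@lebesgue_measure R).

(* Euler's integral; meant for a > 0, where it converges. *)
Definition Gamma (a : R) : R :=
  \int[mu]_(t in `]0, +oo[) (t `^ (a - 1) * expR (- t)).

(* The integer power [^+ j] gives 0 ^+ 0 = 1, which matters at
   Delta = 1, theta = pi, j = 0. *)
Definition ftr_coef (m K Delta : R) (j : nat) : R :=
  Gamma (j%:R + m) / pi *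
  \int[mu]_(theta in `[0, pi])
    ((1 + Delta * cos theta) ^+ j /
     (m + K + K * Delta * cos theta) `^ (j%:R + m)).

(* The terms are nonnegative for x > 0, so the series is taken in [0, +oo]. *)
Definition ftr_pdf (m K Delta sigma2 : R) (x : R) : \bar R :=
  ((m `^ m / Gamma m)%:E *
   \sum_(0 <= j <oo)
     (K ^+ j * ftr_coef m K Delta j / (j`!%:R * j`!%:R) *
      (x ^+ j / (2 * sigma2) ^+ j.+1) * expR (- (x / (2 * sigma2))))%:E)%E.

End ftr.

Section random_variables.
Context {d : measure_display} {T : measurableType d} {R : realType}.
Variable P : probability T R.

(* [f] is only relevant on (0, +oo): the density is 0 elsewhere. *)
Definition has_density_pos (X : {RV P >-> R}) (f : R -> \bar R) : Prop :=
  forall A : set R, measurable A ->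
    distribution P X A =
    (\int[@lebesgue_measure R]_(x in A `&` `]0%R, +oo[) f x)%E.

Definition independent_RV (X Y : {RV P >-> R}) : Prop :=
  forall A B : set R, measurable A -> measurable B ->
    P (X @^-1` A `&` Y @^-1` B) = (P (X @^-1` A) * P (Y @^-1` B))%E.

Definition SOP (gD gE : {RV P >-> R}) (Theta : R) : \bar R :=
  P [set w | gD w < Theta * gE w + Theta - 1].

Definition SOPL (gD gE : {RV P >-> R}) (Theta : R) : \bar R :=
  P [set w | gD w < Theta * gE w].

End random_variables.

(* Main.v *)
(** Expanding both densities gives nonnegative mixtures of Erlang laws with
    scales [2 * sigma2D] and [2 * sigma2E], so by independence and monotone
    convergence everything reduces to comparing an Erlang variable of shape
    [i + 1] with [Theta] times one of shape [j + 1]: a race between two Poisson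
    processes.  Integrating the polynomial-times-exponential tail of the second
    law against the first yields a negative binomial sum, the probability of at
    most [j] failures before the [(i + 1)]-st success, where
    [p = Theta / (Theta + rho * eta)].  Equivalently there are at least [i + 1]
    successes in the first [i + j + 1] trials; this binomial tail is the finite
    sum of the closed form. *)

Require Import Defs.
From mathcomp Require Import measurable_realfun ring lra.

Set Implicit Arguments.
Unset Strict Implicit.
Unset Printing Implicit Defensive.

Local Open Scope classical_set_scope.
Local Open Scope ring_scope.

(** * Negative binomial and binomial tails *)

(** Induction on [j]: an extra trial enlarges the binomial tail by the event of exactly [i]
    successes so far followed by a success, which is the new term on the left. *)
Lemma negative_binomial_tail (F : comPzRingType) (p q : F) (i j : nat) :
  p + q = 1 ->
  \sum_(k < j.+1) 'C(i + k, k)%:R * (p ^+ i.+1 * q ^+ k) =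
  \sum_(k < j.+1) 'C((i + j).+1, (i + k).+1)%:R *
    (p ^+ (i + k).+1 * q ^+ (j - k)).
Proof.
move=> pq1; elim: j => [|j IHj].
  by rewrite !big_ord1 !addn0 bin0 binn.
rewrite big_ord_recr {}IHj /= addnS.
(* Pascal's rule. The last term of the first sum vanishes, and the [k = 0] term of the second is the
   new negative binomial term. *)
have -> : \sum_(k < j.+2) 'C((i + j).+2, (i + k).+1)%:R *
      (p ^+ (i + k).+1 * q ^+ (j.+1 - k)) =
    \sum_(k < j.+2) 'C((i + j).+1, (i + k).+1)%:R *
      (p ^+ (i + k).+1 * q ^+ (j.+1 - k)) +
    \sum_(k < j.+2) 'C((i + j).+1, i + k)%:R *
      (p ^+ (i + k).+1 * q ^+ (j.+1 - k)).
  by rewrite -big_split; apply: eq_bigr => k _; rewrite binS natrD mulrDl.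
rewrite [X in _ = X + _]big_ord_recr [X in _ = _ + X]big_ord_recl /=.
rewrite [in X in _ = _ + X + _]bin_small ?addnS// mul0r addr0.
rewrite addn0 subn0 addrCA addrC; congr (_ + _).
  have ij : (i <= (i + j).+1)%N by rewrite leqW ?leq_addr.
  by rewrite -(bin_sub ij) -addnS addKn.
(* The old sum is multiplied by [p + q]: the [p] part is the shifted second sum, the [q] part the
   first. *)
rewrite -[LHS]mul1r -{1}pq1 mulrDl addrC !mulr_sumr; congr (_ + _).
  apply: eq_bigr => k _; rewrite /bump /= add1n !addnS subSS.
  by rewrite [p ^+ (i + k).+2]exprS; ring.
apply: eq_bigr => k _; rewrite subSn -1?ltnS// [q ^+ _.+1]exprS; ring.
Qed.

(** * Erlang densities, their tails and integrals *)

Section erlang.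
Context {R : realType}.
Notation mu := (@lebesgue_measure R).
Implicit Types (s t a : R) (n : nat).

(* Erlang density of shape [n + 1] and scale [s] without the factor [1 / n!]:
   the total mass is [n!]. *)
Definition erlang (s : R) (n : nat) (t : R) : R :=
  t ^+ n / s ^+ n.+1 * expR (- (t / s)).

(** The upper incomplete gamma function at [n + 1] and [t / s], in closed form. Divided by n!, it is
    the probability that a Poisson variable of mean [t / s] is at most [n]. *)
Definition erlang_tail (s : R) (n : nat) (t : R) : R :=
  n`!%:R * (\sum_(k < n.+1) (t / s) ^+ k / k`!%:R) * expR (- (t / s)).

Lemma erlang_ge0 s n t : 0 < s -> 0 <= t -> 0 <= erlang s n t.
Proof.
by move=> s0 t0; rewrite mulr_ge0 ?expR_ge0// divr_ge0 ?exprn_ge0// ltW.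
Qed.

Lemma erlang_tail_ge0 s n t : 0 < s -> 0 <= t -> 0 <= erlang_tail s n t.
Proof.
move=> s0 t0; rewrite mulr_ge0 ?expR_ge0// mulr_ge0 ?ler0n// sumr_ge0// => k _.
by rewrite divr_ge0 ?ler0n// exprn_ge0// divr_ge0// ltW.
Qed.

Lemma erlang_tailS s n t : erlang_tail s n.+1 t =
  n.+1%:R * erlang_tail s n t + (t / s) ^+ n.+1 * expR (- (t / s)).
Proof.
rewrite /erlang_tail big_ord_recr /= mulrDr mulrDl [n.+1`!]factS natrM.
congr (_ + _); first by rewrite !mulrA.
by rewrite -natrM -factS mulrCA mulfV ?mulr1// pnatr_eq0 -lt0n fact_gt0.
Qed.

Lemma is_derive_div s t : is_derive t 1 (fun x => x / s) s^-1.
Proof.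
rewrite (_ : (fun x => x / s) = s^-1 *: id); last first.
  by apply/funext => x; rewrite /GRing.scale /= mulrC.
by apply: is_derive_eq; rewrite /GRing.scale /= mulr1.
Qed.

Lemma is_derive_expRN_div s t :
  is_derive t 1 (fun x => expR (- (x / s))) (- (s^-1 * expR (- (t / s)))).
Proof.
have := is_derive_div s t => /is_deriveN dN.
by apply: (is_derive_eq (is_derive1_comp _ dN)); rewrite /= mulrN mulrC.
Qed.

(** The derivatives telescope: the term that [erlang_tailS] adds has derivative
    [n.+1%:R * erlang s n t - erlang s n.+1 t], whose first part cancels the induction
    hypothesis. *)
Lemma is_derive_erlang_tail s n t : s != 0 ->
  is_derive t 1 (erlang_tail s n) (- erlang s n t).
Proof.
move=> s0; elim: n => [|n IHn].
  rewrite (_ : erlang_tail s 0 = fun x => expR (- (x / s))); last first.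
    apply/funext => x.
    by rewrite /erlang_tail big_ord1 fact0 expr0 divr1 !mul1r.
  apply: (is_derive_eq (is_derive_expRN_div s t)).
  by rewrite /erlang expr0 expr1 mul1r.
rewrite (_ : erlang_tail s n.+1 = n.+1%:R *: erlang_tail s n +
   (fun x => x / s) ^+ n.+1 * (fun x => expR (- (x / s)))); last first.
  apply/funext => x; rewrite erlang_tailS; congr (_ + _ * _).
  by rewrite fctE.
have dX := is_deriveX n.+1 (is_derive_div s t).
have dM := is_deriveM dX (is_derive_expRN_div s t).
apply: (is_derive_eq (is_deriveD (is_deriveZ n.+1%:R IHn) dM)).
rewrite /erlang /GRing.scale /= !fctE !exprMn !exprVn !exprS.
have sn0 : s ^+ n != 0 by rewrite expf_neq0.
by field; rewrite sn0 s0.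
Qed.

(** For [x > 0], [expR x] exceeds the single Taylor term of degree [n.+1], so the product is at most
    (n+1)! / x. *)
Lemma cvg_exprn_expRN n : x ^+ n * expR (- x) @[x --> +oo] --> (0 : R).
Proof.
apply/cvgrPdist_le => e e0; near=> x.
have x0 : 0 < x by near: x; exact: nbhs_pinfty_gt.
rewrite sub0r normrN ger0_norm; last first.
  by rewrite mulr_ge0 ?expR_ge0 ?exprn_ge0 ?ltW.
rewrite expRN ler_pdivrMr ?expR_gt0//.
have f0 : 0 < n.+1`!%:R :> R by rewrite ltr0n fact_gt0.
have xe : n.+1`!%:R <= e * x.
  by rewrite mulrC -ler_pdivrMr//; near: x; apply: nbhs_pinfty_ge;
    exact: num_real.
rewrite -(ler_pM2l f0) (@le_trans _ _ (e * x ^+ n.+1))//.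
  by rewrite exprS mulrA ler_wpM2r// exprn_ge0// ltW.
rewrite mulrCA ler_pM2l// mulrC -ler_pdivrMr//.
by apply: le_trans (expR_ge1Dxn n (ltW x0)); rewrite lerDr.
Unshelve. all: end_near. Qed.

Lemma cvg_erlang_tail s n : 0 < s -> erlang_tail s n t @[t --> +oo] --> (0 : R).
Proof.
move=> s0.
have cvgX k : (x / s) ^+ k * expR (- (x / s)) @[x --> +oo] --> (0 : R).
  apply: (@cvg_comp _ _ _ (fun x => x / s) (fun x => x ^+ k * expR (- x)) _
    (pinfty_nbhs R)); last exact: cvg_exprn_expRN.
  by apply: gt0_cvgMly; rewrite ?invr_gt0.
elim: n => [|n IHn].
  apply: cvg_trans (cvgX 0); apply: near_eq_cvg; near=> t.
  by rewrite /erlang_tail big_ord1 fact0 expr0 divr1 !mul1r.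
have -> : (0 : R) = n.+1%:R * 0 + 0 by rewrite mulr0 addr0.
under eq_cvg do rewrite erlang_tailS.
by apply: cvgD => //; exact: cvgMr.
Unshelve. all: end_near. Qed.

Lemma continuous_erlang s n : continuous (erlang s n).
Proof.
move=> x; apply: cvgM; last first.
  by have [/derivable1_diffP/differentiable_continuous + _] :=
    is_derive_expRN_div s x; exact.
by apply: cvgMl; exact: exprn_continuous.
Qed.

(** [- erlang_tail s n] is an antiderivative that tends to 0 at infinity, so only its value at [a]
    survives. *)
Lemma integral_erlang s n a : 0 < s -> 0 <= a ->
  (\int[mu]_(t in `]a, +oo[) (erlang s n t)%:E = (erlang_tail s n a)%:E)%E.
Proof.
move=> s0 a0; rewrite integral_itv_obnd_cbnd; last first.
  apply: measurable_funTS; apply/measurable_EFinP.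
  by apply: continuous_measurable_fun; exact: continuous_erlang.
have dF x := is_derive_erlang_tail n x (lt0r_neq0 s0).
have dNF (x : R) : is_derive x 1 (- erlang_tail s n) (erlang s n x).
  by rewrite -[erlang s n x]opprK; exact: is_deriveN.
rewrite (@ge0_continuous_FTC2y _ _ (- erlang_tail s n) _ 0).
- by rewrite /= opprK add0e.
- by move=> x ax; exact: erlang_ge0 (le_trans a0 ax).
- exact/continuous_subspaceT/continuous_erlang.
- by rewrite -oppr0; apply: cvgN; exact: cvg_erlang_tail.
- by move=> x _; have [] := dNF x.
- apply: cvg_at_right_filter.
  by have [/derivable1_diffP/differentiable_continuous + _] := dNF a; exact.
- by move=> x _; rewrite derive1E; have [_ ->] := dNF x.
Qed.

End erlang.

(** * Integration against a measure given by a density *)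

Section density.
Local Open Scope ereal_scope.
Context d (T : measurableType d) (R : realType).
Variables (mu nu : {measure set T -> \bar R}) (D : set T) (f : T -> \bar R).
Hypothesis mD : measurable D.
Hypothesis mf : measurable_fun D f.
Hypothesis f_ge0 : forall x, D x -> 0 <= f x.
Hypothesis nuE : forall A, measurable A -> nu A = \int[mu]_(x in A `&` D) f x.

Import HBNNSimple.

(** For indicators this is [nuE]; linearity extends it to simple functions, and monotone convergence
    along [h] to [g]. *)
Lemma ge0_integral_density (g : T -> \bar R) :
  measurable_fun setT g -> (forall x, 0 <= g x) ->
  \int[nu]_x g x = \int[mu]_(x in D) (g x * f x).
Proof.
move=> mg g0; pose h := nnsfun_approx measurableT mg.
have cvgh x : (EFin \o h ^~ x) @ \oo --> g x by exact: cvg_nnsfun_approx.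
have leh n x : (h n x)%:E <= g x.
  by rewrite /h nnsfun_approxE; exact: le_approx.
transitivity (lim (\int[nu]_x (h n x)%:E @[n --> \oo])).
  under eq_integral => x _ do rewrite -(cvg_lim _ (cvgh x))//.
  apply: monotone_convergence => //.
  - by move=> n; apply/measurable_EFinP.
  - by move=> n x _; rewrite lee_fin.
  - by move=> x _ a b ab; rewrite lee_fin; exact/lefP/nd_nnsfun_approx.
transitivity (lim (\int[mu]_(x in D) ((h n x)%:E * f x) @[n --> \oo]));
    last first.
  rewrite -monotone_convergence//.
  - apply: eq_integral => x; rewrite inE => Dx; apply/cvg_lim => //.
    (* Extended multiplication is not continuous at zero times infinity, so the zeros of [g] and [f]
       are treated apart. Where [g x = 0], the bound [h n x <= g x] forces [h n x = 0]. *)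
    have [gx0|gx0] := eqVneq (g x) 0.
      rewrite gx0 mul0e (_ : (fun _ => _) = cst 0); first exact: cvg_cst.
      apply/funext => n; suff -> : h n x = 0%R by rewrite mul0e.
      by apply/le_anti/andP; split=> //; have := leh n x; rewrite gx0 lee_fin.
    have [fx0|fx0] := eqVneq (f x) 0.
      rewrite fx0 mule0 (_ : (fun _ => _) = cst 0); first exact: cvg_cst.
      by apply/funext => n; rewrite mule0.
    apply: cvgeM; [|exact: cvgh|exact: cvg_cst].
    by rewrite neq0_mule_def// mule_neq0.
  - move=> n; apply: emeasurable_funM => //; apply: measurable_funTS.
    exact/measurable_EFinP.
  - by move=> n x Dx; rewrite mule_ge0 ?lee_fin ?f_ge0.
  - move=> x Dx a b ab; rewrite lee_wpmul2r ?f_ge0// lee_fin.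
    exact/lefP/nd_nnsfun_approx.
congr (lim (_ @ \oo)); apply/funext => n.
under eq_integral => x _ do rewrite fimfunE -fsumEFin//.
under [RHS]eq_integral => x Dx.
  rewrite fimfunE -fsumEFin// ge0_mule_fsuml; last first.
    by move=> r; rewrite nnfun_muleindic_ge0.
  over.
rewrite !ge0_integral_fsum//; last 4 first.
- move=> r; apply: emeasurable_funM => //; apply: measurable_funTS.
  by apply/measurable_EFinP; exact: measurable_funM.
- by move=> r x Dx; rewrite mule_ge0 ?f_ge0// nnfun_muleindic_ge0.
- by move=> r; apply/measurable_EFinP; exact: measurable_funM.
- by move=> r x _; rewrite nnfun_muleindic_ge0.
apply: eq_fsbigr => r; rewrite inE => -[y _ <-].
have mA : measurable (h n @^-1` [set h n y]) by [].
under eq_integral do rewrite EFinM.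
under [RHS]eq_integral do rewrite EFinM -muleA.
rewrite !ge0_integralZl_EFin//; last 3 first.
- by move=> x Dx; rewrite mule_ge0 ?f_ge0// lee_fin.
- apply: emeasurable_funM => //; apply: measurable_funTS.
  by apply/measurable_EFinP.
- by apply/measurable_EFinP.
congr (_ * _).
rewrite integral_indic// setIT nuE// integral_mkcondl.
apply: eq_integral => x _; rewrite patchE indicE.
by case: ifPn => _; rewrite ?mul1e ?mul0e.
Qed.

End density.

(** * Joint laws, measurability and nonnegative series *)

(** The law of the pair and the product of the laws agree on rectangles, which determine the product
    measure. *)
Lemma probability_RV_pair d d1 d2 (T : measurableType d)
    (T1 : measurableType d1) (T2 : measurableType d2) (R : realType)
    (P : probability T R) (X : {RV P >-> T1}) (Y : {RV P >-> T2})
    (A : set (T1 * T2)) :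
  (forall B C, measurable B -> measurable C ->
    P (X @^-1` B `&` Y @^-1` C) = (P (X @^-1` B) * P (Y @^-1` C))%E) ->
  measurable A ->
  P [set w | A (X w, Y w)] = (distribution P X \x distribution P Y)%E A.
Proof.
move=> XY mA.
have mZ : measurable_fun setT (fun w => (X w, Y w)).
  by apply: measurable_fun_pair.
pose Z : {RV P >-> (T1 * T2)%type} := mfun_Sub (mem_set mZ).
by rewrite (@product_measure_unique _ _ _ _ _ _ _ (distribution P Z)).
Qed.

Lemma measurable_set_ltr d (T : measurableType d) (R : realType)
    (f g : T -> R) :
  measurable_fun setT f -> measurable_fun setT g ->
  measurable [set x | f x < g x].
Proof.
move=> mf mg; have := measurable_fun_ltr mf mg measurableT (Y := [set true]).
by rewrite setTI; exact.
Qed.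

(** The factor [x] may be infinite, as is needed when it is itself a series. Over the counting
    measure this is linearity of the integral. *)
Lemma ge0_nneseriesZl (R : realType) (f : nat -> \bar R) (x : \bar R) :
  (0 <= x)%E -> (forall i, (0 <= f i)%E) ->
  (\sum_(0 <= i <oo) (x * f i) = x * \sum_(0 <= i <oo) f i)%E.
Proof.
move=> x0 f0; rewrite -!ge0_integral_count//; last first.
  by move=> i; rewrite mule_ge0.
by rewrite ge0_integralZl.
Qed.

Lemma ge0_emeasurable_nneseries d (T : measurableType d) (R : realType)
    (D : set T) (h : nat -> T -> \bar R) :
  (forall k x, D x -> (0 <= h k x)%E) -> (forall k, measurable_fun D (h k)) ->
  measurable_fun D (fun x => \sum_(0 <= k <oo) h k x)%E.
Proof.
move=> h0 mh; apply: (@ge0_emeasurable_sum _ _ _ D h xpredT) => [k x Dx _|k _].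
  exact: h0.
exact: mh.
Qed.

(** * The race between two Erlang variables *)

Section erlang_race.
Context {R : realType}.
Notation mu := (@lebesgue_measure R).
Implicit Types (s r x : R) (i j k : nat).

Lemma erlang_tail0 s n : erlang_tail s n 0 = n`!%:R.
Proof.
rewrite /erlang_tail mul0r oppr0 expR0 mulr1 big_ord_recl big1 => [|k _].
  by rewrite expr0 fact0 divr1 addr0 mulr1.
by rewrite expr0n mul0r.
Qed.

(** The rates [1 / s] and [1 / r] add up, hence the scale [s * r / (s + r)]. An arrival of the
    merged Poisson process belongs to the first process with probability [r / (s + r)] and to the
    second with probability [s / (s + r)]. *)
Lemma erlangM_tail s r i j x : 0 < s -> 0 < r ->
  erlang s i x * erlang_tail r j x =
  \sum_(k < j.+1)
    j`!%:R / k`!%:R * ((r / (s + r)) ^+ i.+1 * (s / (s + r)) ^+ k) *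
    erlang (s * r / (s + r)) (i + k) x.
Proof.
move=> s0 r0.
have sn0 : s != 0 by rewrite gt_eqF.
have rn0 : r != 0 by rewrite gt_eqF.
have srn0 : s + r != 0 by rewrite gt_eqF ?addr_gt0.
rewrite /erlang_tail mulr_sumr mulr_suml mulr_sumr; apply: eq_bigr => k _.
have -> : j`!%:R / k`!%:R * ((r / (s + r)) ^+ i.+1 * (s / (s + r)) ^+ k) *
    erlang (s * r / (s + r)) (i + k) x =
  x ^+ i / s ^+ i.+1 * (j`!%:R * ((x / r) ^+ k / k`!%:R)) *
    expR (- (x / (s * r / (s + r)))).
  rewrite /erlang -addSn !exprMn !exprVn !exprD.
  have := expf_neq0 i.+1 sn0; have := expf_neq0 i.+1 rn0.
  have := expf_neq0 i.+1 srn0; have := expf_neq0 k sn0.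
  have := expf_neq0 k rn0; have := expf_neq0 k srn0.
  have : k`!%:R != 0 :> R by rewrite pnatr_eq0 -lt0n fact_gt0.
  move: (s ^+ i.+1) (r ^+ i.+1) ((s + r) ^+ i.+1).
  move: (s ^+ k) (r ^+ k) ((s + r) ^+ k).
  move=> a b c a' b' c' ? ? ? ? ? ? ?.
  field.
  by do ?[apply/andP; split].
have -> : - (x / (s * r / (s + r))) = - (x / s) + - (x / r).
  by field; rewrite sn0 rn0 srn0.
by rewrite expRD /erlang; ring.
Qed.

Lemma measurable_erlang s n (D : set R) : measurable_fun D (erlang s n).
Proof.
apply: measurable_funTS.
by apply: continuous_measurable_fun; exact: continuous_erlang.
Qed.

Lemma measurable_erlang_tail s n (D : set R) :
  0 < s -> measurable_fun D (erlang_tail s n).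
Proof.
move=> s0; apply: measurable_funTS; apply: continuous_measurable_fun => x.
by have [/derivable1_diffP/differentiable_continuous] :=
  is_derive_erlang_tail n x (lt0r_neq0 s0).
Qed.

(** Each Erlang term of [erlangM_tail] integrates to its mass (i+k)!, and (i+k)! / k! is i! times
    the binomial coefficient. *)
Lemma integral_erlangM_tail s r i j : 0 < s -> 0 < r ->
  (\int[mu]_(x in `]0%R, +oo[) (erlang s i x * erlang_tail r j x)%:E =
   (i`!%:R * j`!%:R * \sum_(k < j.+1) 'C(i + k, k)%:R *
     ((r / (s + r)) ^+ i.+1 * (s / (s + r)) ^+ k))%:E)%E.
Proof.
move=> s0 r0.
have w0 : 0 < s * r / (s + r) by rewrite divr_gt0 ?mulr_gt0 ?addr_gt0.
have p0 : 0 <= r / (s + r) by rewrite divr_ge0 ?addr_ge0 ?ltW.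
have q0 : 0 <= s / (s + r) by rewrite divr_ge0 ?addr_ge0 ?ltW.
under eq_integral do rewrite erlangM_tail// -sumEFin.
rewrite ge0_integral_sum//; last 2 first.
- move=> k; apply/measurable_EFinP; apply: measurable_funM => //.
  exact: measurable_erlang.
- move=> k x /=; rewrite in_itv/= andbT => x0; rewrite lee_fin.
  by rewrite mulr_ge0 ?erlang_ge0 ?(ltW x0)// !mulr_ge0 ?invr_ge0 ?exprn_ge0.
rewrite mulr_sumr -sumEFin; apply: eq_bigr => k _.
under eq_integral do rewrite EFinM.
rewrite ge0_integralZl_EFin//; last 3 first.
- move=> x /=; rewrite in_itv/= andbT => x0; rewrite lee_fin.
  by rewrite erlang_ge0// ltW.
- by apply/measurable_EFinP; exact: measurable_erlang.
- by rewrite !mulr_ge0 ?invr_ge0 ?exprn_ge0.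
rewrite integral_erlang// erlang_tail0 -EFinM; congr EFin.
have /(congr1 (fun n => n%:R : R)) := bin_fact (leq_addl i k).
rewrite addnK !natrM => <-.
have k0 : k`!%:R != 0 :> R by rewrite pnatr_eq0 -lt0n fact_gt0.
by field.
Qed.

End erlang_race.

(** * Comparison of two independent Erlang mixtures *)

Section erlang_mixture.
Context {R : realType}.
Notation mu := (@lebesgue_measure R).
Implicit Types (a b c s r t : R) (u v : nat -> R).

(** Since [erlang s i] has mass i!, the mixing weight of the [i]-th Erlang law is [c * u i] times
    i!. *)
Definition erlang_mixture (c : R) (u : nat -> R) (s x : R) : \bar R :=
  (c%:E * \sum_(0 <= i <oo) (u i * erlang s i x)%:E)%E.

Lemma erlang_mixture_ge0 (c : R) u s x : 0 <= c -> (forall i, 0 <= u i) ->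
  0 < s -> 0 <= x -> (0 <= erlang_mixture c u s x)%E.
Proof.
move=> c0 u0 s0 x0; rewrite mule_ge0 ?lee_fin// nneseries_ge0// => i _ _.
by rewrite lee_fin mulr_ge0// erlang_ge0.
Qed.

Lemma measurable_erlang_mixture (c : R) u s : 0 < s -> (forall i, 0 <= u i) ->
  measurable_fun (`]0, +oo[ : set R) (erlang_mixture c u s).
Proof.
move=> s0 u0; apply: measurable_funeM.
apply: ge0_emeasurable_nneseries => [i x /=|i].
  by rewrite in_itv/= andbT => x0; rewrite lee_fin mulr_ge0// erlang_ge0// ltW.
apply/measurable_EFinP; apply: measurable_funM => //.
exact: measurable_erlang.
Qed.

Lemma integral_erlang_mixture (c : R) u s a : 0 <= c -> (forall i, 0 <= u i) ->
  0 < s -> 0 <= a ->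
  (\int[mu]_(x in `]a, +oo[) erlang_mixture c u s x =
   c%:E * \sum_(0 <= i <oo) (u i * erlang_tail s i a)%:E)%E.
Proof.
move=> c0 u0 s0 a0.
have mui i : measurable_fun `]a, +oo[ (fun x => (u i * erlang s i x)%:E).
  apply/measurable_EFinP; apply: measurable_funM => //.
  exact: measurable_erlang.
have ui0 i x : `]a, +oo[%classic x -> (0 <= (u i * erlang s i x)%:E)%E.
  rewrite /= in_itv/= andbT => ax.
  by rewrite lee_fin mulr_ge0// erlang_ge0// (le_trans a0)// ltW.
rewrite ge0_integralZl_EFin//; last 2 first.
- by move=> x Dx; apply: nneseries_ge0 => i _ _; exact: ui0.
- exact: ge0_emeasurable_nneseries.
congr (_ * _)%E; rewrite integral_nneseries//.
apply: eq_eseriesr => i _; under eq_integral do rewrite EFinM.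
rewrite ge0_integralZl_EFin//.
- by rewrite integral_erlang.
- move=> x /=; rewrite in_itv/= andbT => ax.
  by rewrite lee_fin erlang_ge0// (le_trans a0)// ltW.
- by apply/measurable_EFinP; exact: measurable_erlang.
Qed.

(** For [t > 0], multiplying an Erlang variable by [t] multiplies its scale by [t]; this absorbs the
    factor in front of [Y]. *)
Lemma erlang_tail_div (s t x : R) n :
  erlang_tail s n (x / t) = erlang_tail (t * s) n x.
Proof. by rewrite /erlang_tail invfM mulrA. Qed.

(** Given [X = x], the event is [Y > x / t], whose probability is a series of Erlang tails. Against
    the density of [X] this leaves one race for each pair of indices. *)
Lemma probability_lt_erlang_mixture d (T : measurableType d)
    (P : probability T R) (X Y : {RV P >-> R}) (a b s r t : R)
    (u v : nat -> R) :
  0 <= a -> 0 <= b -> (forall i, 0 <= u i) -> (forall j, 0 <= v j) ->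
  0 < s -> 0 < r -> 0 < t ->
  has_density_pos X (erlang_mixture a u s) ->
  has_density_pos Y (erlang_mixture b v r) ->
  independent_RV X Y ->
  P [set w | X w < t * Y w] =
  ((a * b)%:E * \sum_(0 <= i <oo) \sum_(0 <= j <oo)
    (u i * v j * (i`!%:R * j`!%:R * \sum_(k < j.+1) 'C(i + k, k)%:R *
     ((t * r / (s + t * r)) ^+ i.+1 * (s / (s + t * r)) ^+ k)))%:E)%E.
Proof.
move=> a0 b0 u0 v0 s0 r0 t0 dX dY XY.
have tr0 : 0 < t * r by rewrite mulr_gt0.
(* [lebesgue_measure] lives on [measurableTypeR R], which has the measurable
   sets of [R] but another display; [X] is retyped so that its law and the
   Lebesgue measure are measures on the same type. *)
have mX : @measurable_fun _ _ T (measurableTypeR R) setT X.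
  by move=> _ B mB; exact: (measurable_funPT X).
pose X' : {RV P >-> measurableTypeR R} :=
  @mfun_Sub _ _ T (measurableTypeR R) X (mem_set mX).
pose A := [set z : measurableTypeR R * R | z.1 < t * z.2].
have mA : measurable A.
  apply: measurable_set_ltr; first exact: measurable_fst.
  by apply: measurable_funM => //; exact: measurable_snd.
rewrite (@probability_RV_pair _ _ _ _ _ _ _ _ X' Y A)//.
(* The product measure of [A] is the integral over [x] of the law of [Y] on the section of [A] at
   [x]. *)
rewrite /product_measure1.
have mx : measurable (`]0, +oo[ : set (measurableTypeR R)) by [].
rewrite (ge0_integral_density (mu := mu) (nu := distribution P X') mx
  (measurable_erlang_mixture a s0 u0) _ dX)//; last 2 first.
- move=> x /=; rewrite in_itv/= andbT => /ltW x0.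
  exact: erlang_mixture_ge0.
- exact: measurable_fun_xsection.
have tailE (x : R) : x \in `]0, +oo[%classic ->
    (distribution P Y \o xsection A) x =
    (b%:E * \sum_(0 <= j <oo) (v j * erlang_tail (t * r) j x)%:E)%E.
  rewrite inE/= in_itv/= andbT => x0.
  rewrite dY; last exact: measurable_xsection.
  (* Because [x > 0], every [y] in the section is positive, so the restriction to the positive axis
     changes nothing. *)
  rewrite (_ : _ `&` _ = `]x / t, +oo[%classic); last first.
    apply/seteqP; split => y /=; rewrite !in_itv/= !andbT.
      by move=> [/xsectionP/= /[!ltr_pdivrMr]//]; rewrite mulrC.
    rewrite ltr_pdivrMr// => xy; split.
      by apply/xsectionP; rewrite /A/= mulrC.
    by rewrite -(pmulr_lgt0 _ t0) (lt_trans x0).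
  rewrite integral_erlang_mixture// ?divr_ge0 ?ltW//.
  by under eq_eseriesr do rewrite erlang_tail_div.
have uv0 i j : 0 <= u i * v j by rewrite mulr_ge0.
have eT0 i j x : 0 <= x -> 0 <= erlang s i x * erlang_tail (t * r) j x.
  by move=> x0; apply: mulr_ge0; [exact: erlang_ge0|exact: erlang_tail_ge0].
pose g i j x := (u i * v j * (erlang s i x * erlang_tail (t * r) j x))%:E.
have g0 i j x : `]0, +oo[%classic x -> (0 <= g i j x)%E.
  rewrite /= in_itv/= andbT => /ltW x0; rewrite lee_fin.
  exact: mulr_ge0 (uv0 i j) (eT0 _ _ _ x0).
have mg i j : measurable_fun (`]0, +oo[%classic : set R) (g i j).
  apply/measurable_EFinP; apply: measurable_funM => //.
  apply: measurable_funM; first exact: measurable_erlang.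
  exact: measurable_erlang_tail.
(* The product of the two series becomes a double series of nonnegative terms, which monotone
   convergence allows to integrate term by term. *)
under eq_integral => x xD.
  rewrite tailE// (_ : (_ * _)%E =
    ((a * b)%:E * \sum_(0 <= i <oo) \sum_(0 <= j <oo) g i j x)%E); last first.
    move: xD; rewrite inE/= in_itv/= andbT => /ltW x0.
    rewrite muleACA -EFinM [(b * a)%R]mulrC; congr (_ * _)%E.
    rewrite -ge0_nneseriesZl; last 2 first.
    - apply: nneseries_ge0 => j _ _.
      by rewrite lee_fin mulr_ge0 ?erlang_tail_ge0.
    - by move=> i; rewrite lee_fin mulr_ge0 ?erlang_ge0.
    apply: eq_eseriesr => i _; rewrite muleC -ge0_nneseriesZl; last 2 first.
    - by rewrite lee_fin mulr_ge0 ?erlang_ge0.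
    - by move=> j; rewrite lee_fin mulr_ge0 ?erlang_tail_ge0.
    by apply: eq_eseriesr => j _; rewrite -EFinM mulrACA.
  over.
rewrite ge0_integralZl_EFin//; last 3 first.
- move=> x Dx; apply: nneseries_ge0 => i _ _.
  by apply: nneseries_ge0 => j _ _; exact: g0.
- apply: ge0_emeasurable_nneseries => [i x Dx|i].
    by apply: nneseries_ge0 => j _ _; exact: g0.
  by apply: ge0_emeasurable_nneseries => [j x|j]; [exact: g0|exact: mg].
- exact: mulr_ge0.
congr (_ * _)%E.
rewrite integral_nneseries//; last 2 first.
- move=> i.
  by apply: ge0_emeasurable_nneseries => [j x|j]; [exact: g0|exact: mg].
- by move=> i x Dx; apply: nneseries_ge0 => j _ _; exact: g0.
apply: eq_eseriesr => i _; rewrite integral_nneseries//; last 2 first.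
- by move=> j; exact: mg.
- by move=> j x Dx; exact: g0.
apply: eq_eseriesr => j _.
rewrite /g; under eq_integral do rewrite EFinM.
rewrite ge0_integralZl_EFin//; last 2 first.
- move=> x /=; rewrite in_itv/= andbT => /ltW x0; rewrite lee_fin.
  exact: eT0.
- apply/measurable_EFinP.
  apply: measurable_funM; first exact: measurable_erlang.
  exact: measurable_erlang_tail.
by rewrite integral_erlangM_tail.
Qed.

End erlang_mixture.

(** * FTR densities as Erlang mixtures, and the finite sum of the closed form *)

Section ftr_erlang.
Context {R : realType}.
Implicit Types m K Delta : R.

Lemma Gamma_ge0 (a : R) : 0 <= Gamma a.
Proof.
by apply: Rintegral_ge0 => t _; rewrite mulr_ge0 ?powR_ge0 ?expR_ge0.
Qed.

Lemma ftr_coef_ge0 m K Delta j : 0 <= Delta <= 1 -> 0 <= ftr_coef m K Delta j.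
Proof.
move=> /andP[D0 D1]; rewrite mulr_ge0 ?divr_ge0 ?Gamma_ge0 ?pi_ge0//.
apply: Rintegral_ge0 => theta _; rewrite divr_ge0 ?powR_ge0// exprn_ge0//.
(* The base is at least [1 - Delta]. *)
by have := cos_geN1 theta; nra.
Qed.

Lemma ftr_weight_ge0 m K Delta j : 0 <= K -> 0 <= Delta <= 1 ->
  0 <= K ^+ j * ftr_coef m K Delta j / (j`!%:R * j`!%:R).
Proof.
move=> K0 D01; apply: divr_ge0; apply: mulr_ge0; rewrite ?ler0n//.
  exact: exprn_ge0.
exact: ftr_coef_ge0.
Qed.

Lemma ftr_pdfE m K Delta (sigma2 : R) : ftr_pdf m K Delta sigma2 =
  erlang_mixture (m `^ m / Gamma m)
    (fun j => K ^+ j * ftr_coef m K Delta j / (j`!%:R * j`!%:R)) (2 * sigma2).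
Proof.
apply/funext => x; congr (_ * _)%E; apply: eq_eseriesr => j _.
by rewrite /erlang -mulrA.
Qed.

(** This is [negative_binomial_tail] at [p = t / (t + x)] and [q = x / (t + x)], where
    [p ^+ (i + k).+1 * q ^+ (j - k)] depends on [k] only through [(t / x) ^+ k]. *)
Lemma binomial_tail_ratio (x t : R) i j : 0 < x -> 0 < t ->
  \sum_(k < j.+1)
    'C(i + k, k)%:R * ((t / (t + x)) ^+ i.+1 * (x / (t + x)) ^+ k) =
  x ^+ j * t ^+ i.+1 / (t + x) ^+ (i + j + 1) *
  \sum_(0 <= k < j.+1) ((t / x) ^+ k *
    ((i + j + 1)`!%:R / ((i + 1 + k)`!%:R * (j - k)`!%:R))).
Proof.
move=> x0 t0; have xn0 : x != 0 by rewrite gt_eqF.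
have txn0 : t + x != 0 by rewrite gt_eqF ?addr_gt0.
rewrite negative_binomial_tail; last by rewrite -mulrDl divff.
rewrite big_mkord mulr_sumr; apply: eq_bigr => -[k /= kj] _.
(* Writing [j = k + l] removes the truncated subtraction from exponents and factorials. *)
have jE : j = (k + (j - k))%N by rewrite subnKC.
move: (j - k)%N jE => l ->.
have lik : ((i + k).+1 <= (i + (k + l)).+1)%N by rewrite addnA ltnS leq_addr.
have binE := bin_fact lik; rewrite subSS addnA addKn in binE.
rewrite !addn1 addSn !addnA.
have <- : 'C((i + k + l).+1, (i + k).+1)%:R * ((i + k).+1`!%:R * l`!%:R) =
    (i + k + l).+1`!%:R :> R by rewrite -!natrM binE.
have := expf_neq0 i txn0; have := expf_neq0 k txn0; have := expf_neq0 l txn0.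
have := expf_neq0 k xn0.
have : (i + k).+1`!%:R != 0 :> R by rewrite pnatr_eq0 -lt0n fact_gt0.
have : l`!%:R != 0 :> R by rewrite pnatr_eq0 -lt0n fact_gt0.
rewrite !exprMn !exprVn !exprS !exprD.
move: (x ^+ k) (x ^+ l) ((t + x) ^+ i) ((t + x) ^+ k) ((t + x) ^+ l) (l`!%:R).
move=> a b c e f g g0 h0 a0 f0 e0 c0.
field.
by rewrite !(g0, h0, a0, f0, e0, c0, txn0).
Qed.

End ftr_erlang.

(** * The lower bound on the secrecy outage probability and its value *)

Theorem lemma3 (R : realType) (d : measure_display) (T : measurableType d)
    (P : probability T R) (gD gE : {RV P >-> R})
    (mD KD DeltaD sigma2D mE KE DeltaE sigma2E Rs : R)
    (mD_gt0 : 0 < mD) (KD_ge0 : 0 <= KD) (DeltaD01 : 0 <= DeltaD <= 1)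
    (sigma2D_gt0 : 0 < sigma2D)
    (mE_gt0 : 0 < mE) (KE_ge0 : 0 <= KE) (DeltaE01 : 0 <= DeltaE <= 1)
    (sigma2E_gt0 : 0 < sigma2E)
    (Rs_ge0 : 0 <= Rs)
    (gD_ge0 : forall w, 0 <= gD w) (gE_ge0 : forall w, 0 <= gE w)
    (gD_density : has_density_pos gD (ftr_pdf mD KD DeltaD sigma2D))
    (gE_density : has_density_pos gE (ftr_pdf mE KE DeltaE sigma2E))
    (gDgE_indep : independent_RV gD gE) :
  let Theta := expR Rs in
  let rho := (sigma2D * (KD + 1)) / (sigma2E * (KE + 1)) in
  let eta := (KE + 1) / (KD + 1) in
  (SOPL gD gE Theta <= SOP gD gE Theta)%E /\
  SOPL gD gE Theta =
  (((mD `^ mD * mE `^ mE) / (Gamma mD * Gamma mE))%:E *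
   \sum_(0 <= jD <oo) \sum_(0 <= jE <oo)
     ((KD ^+ jD * ftr_coef mD KD DeltaD jD *
       (KE ^+ jE * ftr_coef mE KE DeltaE jE)) / (jD`!%:R * jE`!%:R) *
      (((rho * eta) ^+ jE * Theta ^+ jD.+1) /
       (Theta + rho * eta) ^+ (jD + jE + 1)) *
      \sum_(0 <= k < jE.+1)
        ((Theta / (rho * eta)) ^+ k *
         ((jD + jE + 1)`!%:R / ((jD + 1 + k)`!%:R * (jE - k)`!%:R))))%:E)%E.
Proof.
move=> Theta rho eta.
have Theta_gt0 : 0 < Theta by exact: expR_gt0.
have Theta_ge1 : 1 <= Theta by rewrite -expR0 ler_expR.
have mgD : measurable_fun setT gD by [].
have mgE : measurable_fun setT (fun w => Theta * gE w).
  by apply: measurable_funM.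
split.
  rewrite /SOPL /SOP; apply: le_measure; rewrite ?inE.
  - exact: measurable_set_ltr.
  - apply: measurable_set_ltr => //.
    by apply: measurable_funB => //; exact: measurable_funD.
  (* The threshold of [SOP] is larger by [Theta - 1], which is nonnegative. *)
  - by move=> w /= gDE; rewrite -addrA ltr_wpDr// subr_ge0.
(* The factors [K + 1] cancel, so [rho * eta] is the ratio of the two Erlang scales. *)
have rho_eta : rho * eta = sigma2D / sigma2E.
  have KD1 : KD + 1 != 0 by rewrite gt_eqF// ltr_wpDl.
  have KE1 : KE + 1 != 0 by rewrite gt_eqF// ltr_wpDl.
  by rewrite /rho /eta; field; rewrite KD1 KE1 gt_eqF.
have x_gt0 : 0 < rho * eta by rewrite rho_eta divr_gt0.
move: gD_density gE_density; rewrite !ftr_pdfE => gD_density gE_density.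
rewrite /SOPL.
rewrite (probability_lt_erlang_mixture _ _ _ _ _ _ _ gD_density gE_density)//;
  last first.
- by rewrite mulr_gt0.
- by rewrite mulr_gt0.
- by move=> j; exact: ftr_weight_ge0.
- by move=> j; exact: ftr_weight_ge0.
- by rewrite divr_ge0 ?powR_ge0 ?Gamma_ge0.
- by rewrite divr_ge0 ?powR_ge0 ?Gamma_ge0.
rewrite mulrACA -invfM; congr (_ * _)%E.
apply: eq_eseriesr => i _; apply: eq_eseriesr => j _; congr EFin.
have sE0 : sigma2E != 0 by rewrite gt_eqF.
have tx0 : sigma2D + Theta * sigma2E != 0.
  by rewrite gt_eqF// addr_gt0 ?mulr_gt0.
have tx0' : 2 * sigma2D + Theta * (2 * sigma2E) != 0.
  by rewrite mulrCA -mulrDr mulf_neq0// pnatr_eq0.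
have tx0'' : Theta * sigma2E + sigma2D != 0 by rewrite addrC.
(* Dividing numerator and denominator by [2 * sigma2E] turns both race probabilities into functions
   of [Theta] and [rho * eta]. *)
have -> : Theta * (2 * sigma2E) / (2 * sigma2D + Theta * (2 * sigma2E)) =
    Theta / (Theta + rho * eta).
  by rewrite rho_eta; field; do ?[apply/andP; split].
have -> : 2 * sigma2D / (2 * sigma2D + Theta * (2 * sigma2E)) =
    rho * eta / (Theta + rho * eta).
  by rewrite rho_eta; field; do ?[apply/andP; split].
rewrite (binomial_tail_ratio _ _ x_gt0 Theta_gt0).
(* Each FTR weight carries a squared factorial; the Erlang masses i! and j! cancel one copy of
   each. *)
have i0 : i`!%:R != 0 :> R by rewrite pnatr_eq0 -lt0n fact_gt0.
have j0 : j`!%:R != 0 :> R by rewrite pnatr_eq0 -lt0n fact_gt0.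
move: (KD ^+ i * _) (KE ^+ j * _) (i`!%:R) (j`!%:R) i0 j0 => p q f g f0 g0.
set B := _ / _ ^+ (i + j + 1); set S := \sum_(0 <= k < j.+1) _.
by move: B S => B S; field; rewrite f0 g0.
Qed.
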